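(* Let $A$ be a weak GCD domain and $(M_i)_{i\in I}$ a family of PS modules over $A$. Then the direct product $\prod_{i\in I} M_i$ is a PS module over $A$.
   Context: All rings are commutative and unitary. For an integral domain $A$, a torsion-free $A$-module $M$ is a PS module (pre-Schreier module) if every equality $ax=by$ with $a,b\in A-\{0\}$ and $x,y\in M-\{0\}$ has a refinement, i.e. there exist $c,d,e\in A$ and $z\in M$ with $a=ce$, $b=cd$, $x=dz$, $y=ez$. An integral domain $A$ is a weak GCD domain if each pair $a,b\in A-\{0\}$ has a maximal common divisor, that is, a common divisor $d$ such that $\gcd(a/d,b/d)=1$ (the only common divisors of $a/d$ and $b/d$ are units). *)

(* Defs.v *)
From HB Require Import structures.
From mathcomp Require Import all_boot all_algebra.
From mathcomp Require Import boolp.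

Set Implicit Arguments.
Unset Strict Implicit.
Unset Printing Implicit Defensive.

Import GRing.Theory.
Local Open Scope ring_scope.

Section Divisibility.
Variable A : idomainType.

Definition divides (d a : A) : Prop := exists q : A, a = d * q.

(* gcd(a, b) = 1 in the sense "the only common divisors are units" *)
Definition gcd_eq1 (a b : A) : Prop :=
  forall d : A, divides d a -> divides d b -> d \is a GRing.unit.

(* For a nonzero, a' and b' are the quotients a/d and b/d; the ring division
   a / d of the library is only meaningful when d is a unit. *)
Definition maximal_common_divisor (d a b : A) : Prop :=
  exists a' b' : A, [/\ a = d * a', b = d * b' & gcd_eq1 a' b'].

Definition weak_GCD_domain : Prop :=
  forall a b : A, a != 0 -> b != 0 ->
    exists d : A, maximal_common_divisor d a b.

End Divisibility.

Arguments weak_GCD_domain A : clear implicits.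

Section PSModules.
Variables (A : idomainType) (M : lmodType A).

Definition torsion_free : Prop :=
  forall (a : A) (x : M), a *: x = 0 -> a = 0 \/ x = 0.

Definition has_refinement (a b : A) (x y : M) : Prop :=
  exists (c d e : A) (z : M),
    [/\ a = c * e, b = c * d, x = d *: z & y = e *: z].

Definition PS_module : Prop :=
  torsion_free /\
  forall (a b : A) (x y : M),
    a != 0 -> b != 0 -> x != 0 -> y != 0 ->
    a *: x = b *: y -> has_refinement a b x y.

End PSModules.

Arguments torsion_free {A} M.
Arguments PS_module {A} M.

(* The library has the function module T -> V, but not the product of a
   dependent family; the structure on [direct_product M] is componentwise. *)
Definition direct_product (A : pzRingType) (I : Type) (M : I -> lmodType A) :
  Type := forall i : I, M i.

Section DirectProduct.
Variables (A : pzRingType) (I : Type) (M : I -> lmodType A).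
Local Notation P := (direct_product M).
Implicit Types (f g h : P) (a b : A).

HB.instance Definition _ := gen_eqMixin P.
HB.instance Definition _ := gen_choiceMixin P.

Definition dp_zero : P := fun i => 0.
Definition dp_opp f : P := fun i => - f i.
Definition dp_add f g : P := fun i => f i + g i.
Definition dp_scale a f : P := fun i => a *: f i.

Fact dp_addA : associative dp_add.
Proof. by move=> f g h; apply: functional_extensionality_dep => i; exact: addrA. Qed.

Fact dp_addC : commutative dp_add.
Proof. by move=> f g; apply: functional_extensionality_dep => i; exact: addrC. Qed.

Fact dp_add0 : left_id dp_zero dp_add.
Proof. by move=> f; apply: functional_extensionality_dep => i; exact: add0r. Qed.

Fact dp_addN : left_inverse dp_zero dp_opp dp_add.
Proof. by move=> f; apply: functional_extensionality_dep => i; exact: addNr. Qed.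

HB.instance Definition _ :=
  GRing.isZmodule.Build P dp_addA dp_addC dp_add0 dp_addN.

Fact dp_scaleA a b f : dp_scale a (dp_scale b f) = dp_scale (a * b) f.
Proof. by apply: functional_extensionality_dep => i; exact: scalerA. Qed.

Fact dp_scale1 : left_id 1 dp_scale.
Proof. by move=> f; apply: functional_extensionality_dep => i; exact: scale1r. Qed.

Fact dp_scaleDr : right_distributive dp_scale +%R.
Proof. by move=> a f g; apply: functional_extensionality_dep => i; exact: scalerDr. Qed.

Fact dp_scaleDl f : {morph dp_scale^~ f : a b / a + b}.
Proof. by move=> a b; apply: functional_extensionality_dep => i; exact: scalerDl. Qed.

HB.instance Definition _ :=
  GRing.Zmodule_isLmodule.Build A P dp_scaleA dp_scale1 dp_scaleDr dp_scaleDl.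

End DirectProduct.

(* Main.v *)
(** Cancel a maximal common divisor [c] of [a] and [b], leaving [a' x = b' y]
    with [gcd(a', b') = 1].  A refinement of this equality in a single PS module
    has a unit as first factor, so [x = b' z] and [y = a' z] for some [z].
    The scalars [c], [b'], [a'] do not depend on the component, hence the
    vectors [z] of all components assemble into one refinement in the product. *)

Require Import Defs.
From mathcomp Require Import all_boot all_algebra.
From mathcomp Require Import boolp.

Set Implicit Arguments.
Unset Strict Implicit.
Unset Printing Implicit Defensive.

Import GRing.Theory.
Local Open Scope ring_scope.

Lemma torsion_free_scalerI (A : idomainType) (M : lmodType A) (a : A) :
  torsion_free M -> a != 0 -> injective (fun x : M => a *: x).
Proof.
move=> tfM a0 x y /= axy.
have /tfM[/eqP|/eqP] : a *: (x - y) = 0 by rewrite scalerBr axy subrr.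
  by rewrite (negPf a0).
by rewrite subr_eq0 => /eqP.
Qed.

(** Zero vectors are allowed, since a nonzero family can have zero components. *)
Lemma PS_module_coprime (A : idomainType) (M : lmodType A) (a b : A) (x y : M) :
  PS_module M -> a != 0 -> b != 0 -> gcd_eq1 a b -> a *: x = b *: y ->
  exists z : M, x = b *: z /\ y = a *: z.
Proof.
move=> [tfM refM] a0 b0 ab1 axby.
(* The PS condition covers nonzero vectors only; if [x] or [y] vanishes, torsion-freeness kills the
   other and [0] serves as [z]. *)
have [x0|x0] := eqVneq x 0.
  exists 0; rewrite !scaler0; split=> //.
  by apply: (torsion_free_scalerI tfM b0); rewrite /= -axby x0 !scaler0.
have [y0|y0] := eqVneq y 0.
  exists 0; rewrite !scaler0; split=> //.
  by apply: (torsion_free_scalerI tfM a0); rewrite /= axby y0 !scaler0.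
have [c [d [e [z [ace bcd -> ->]]]]] := refM a b x y a0 b0 x0 y0 axby.
have cU : c \is a GRing.unit by apply: ab1; [exists e | exists d].
(* The inverse of [c] compensates for replacing [d] by [b = c * d] and [e] by [a = c * e]. *)
by exists (c^-1 *: z); rewrite !scalerA ace bcd ![c * _]mulrC !mulrK.
Qed.

Lemma direct_product_torsion_free (A : idomainType) (I : Type)
    (M : I -> lmodType A) :
  (forall i, torsion_free (M i)) -> torsion_free (direct_product M).
Proof.
move=> tfM a x ax0; have [->|a0] := eqVneq a 0; first by left.
right; apply: functional_extensionality_dep => i.
have /tfM[/eqP|//] : a *: x i = 0 := congr1 (fun f : direct_product M => f i) ax0.
by rewrite (negPf a0).
Qed.

Theorem theorem4p8 (A : idomainType) (I : Type) (M : I -> lmodType A)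
    (hA : weak_GCD_domain A) (hM : forall i : I, PS_module (M i)) :
  PS_module (direct_product M).
Proof.
split=> [|a b x y a0 b0 _ _ axby].
  by apply: direct_product_torsion_free => i; case: (hM i).
have [c [a' [b' [ac bc ab1]]]] := hA a b a0 b0.
move: (a0) (b0); rewrite ac bc !mulf_eq0 !negb_or => /andP[c0 a'0] /andP[_ b'0].
have zP i : exists z : M i, x i = b' *: z /\ y i = a' *: z.
  apply: PS_module_coprime => //.
  apply: (torsion_free_scalerI (proj1 (hM i)) c0); rewrite /= !scalerA -ac -bc.
  exact: (congr1 (fun f : direct_product M => f i) axby).
(* Choice, through [cid], picks one [z] per index. *)
exists c, b', a', (fun i => projT1 (cid (zP i))).
by split=> //; apply: functional_extensionality_dep => i;
  case: (projT2 (cid (zP i))).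
Qed.
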